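(* Let $D$ be a division ring with center $F$ and let $N$ be a non-central almost subnormal subgroup of $D^*$. If $\mathrm{char}(D)=0$ and there exists an element $a\in D\setminus F$ such that $axa^{-1}x^{-1}$ is algebraic over $F$ of bounded degree for all $x\in N$ (i.e. there is a positive integer $d$ such that for all $x\in N$ the element $axa^{-1}x^{-1}$ is algebraic over $F$ of degree at most $d$), then $D$ is centrally finite.
   Context: $D^*$ is the multiplicative group of $D$. $D$ is centrally finite if it is a finite-dimensional vector space over its center $F$. A subgroup of $D^*$ is non-central if it is not contained in $F$. A subgroup $N$ of a group $G$ is almost subnormal in $G$ if there is a finite series of subgroups $N=N_r\le N_{r-1}\le\cdots\le N_0=G$ such that for each $1\le i\le r$, either $N_i$ is normal in $N_{i-1}$ or $N_i$ has finite index in $N_{i-1}$. *)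

(* Defs.v *)
From HB Require Import structures.
From mathcomp Require Import all_boot all_order all_algebra.
From mathcomp Require Import boolp classical_sets cardinality.

Set Implicit Arguments.
Unset Strict Implicit.
Unset Printing Implicit Defensive.

Import GRing.Theory.

(* Subgroups are Prop-valued sets, since the groups here are infinite; [mem H]
   turns such a set into the predicate expected by [group_closed]. *)
Section AlmostSubnormal.
Local Open Scope classical_set_scope.
Local Open Scope group_scope.

Variable G : groupType.
Implicit Types H K N : set G.

Definition subgroup H : Prop := group_closed (mem H).

Definition left_coset K (x : G) : set G := [set x * k | k in K].

Definition normal_in K H : Prop := forall x k, H x -> K k -> K (k ^ x).

Definition finite_index_in K H : Prop :=
  finite_set [set left_coset K x | x in H].

Definition almost_subnormal N : Prop :=
  exists (r : nat) (S : nat -> set G),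
    [/\ S 0%N = [set: G],
        S r = N,
        (forall i, (i <= r)%N -> subgroup (S i)) &
        forall i, (i < r)%N ->
          S i.+1 `<=` S i /\
          (normal_in (S i.+1) (S i) \/ finite_index_in (S i.+1) (S i))].

End AlmostSubnormal.

Local Open Scope ring_scope.

HB.mixin Record UnitRing_isDivisionRing D of GRing.UnitRing D := {
  divring_unitP : forall x : D, x != 0 -> x \is a GRing.unit
}.

#[short(type="divisionRingType")]
HB.structure Definition DivisionRing :=
  { D of UnitRing_isDivisionRing D & GRing.UnitRing D }.

Section UnitGroup.
Variable R : unitRingType.

Definition unit_group : Type := {x : R | x \is a GRing.unit}.

HB.instance Definition _ := [isSub of unit_group for sval].
HB.instance Definition _ := [Choice of unit_group by <:].

Implicit Types u v w : unit_group.

Definition unit_one : unit_group :=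
  exist (fun x : R => x \is a GRing.unit) 1 (unitr1 R).

Fact unit_mul_subproof u v : val u * val v \is a GRing.unit.
Proof. by rewrite unitrMl (valP u, valP v). Qed.
Definition unit_mul u v : unit_group :=
  exist (fun x : R => x \is a GRing.unit) _ (unit_mul_subproof u v).

Fact unit_inv_subproof u : (val u)^-1 \is a GRing.unit.
Proof. by rewrite unitrV (valP u). Qed.
Definition unit_inv u : unit_group :=
  exist (fun x : R => x \is a GRing.unit) _ (unit_inv_subproof u).

Fact unit_mulA : associative unit_mul.
Proof. by move=> u v w; apply: val_inj; rewrite /= mulrA. Qed.
Fact unit_mul1 : left_id unit_one unit_mul.
Proof. by move=> u; apply: val_inj; rewrite /= mul1r. Qed.
Fact unit_mulr1 : right_id unit_one unit_mul.
Proof. by move=> u; apply: val_inj; rewrite /= mulr1. Qed.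
Fact unit_mulV : left_inverse unit_one unit_inv unit_mul.
Proof. by move=> u; apply: val_inj; exact: mulVr (valP u). Qed.
Fact unit_mulrV : right_inverse unit_one unit_inv unit_mul.
Proof. by move=> u; apply: val_inj; exact: mulrV (valP u). Qed.

HB.instance Definition _ := isGroup.Build unit_group
  unit_mulA unit_mul1 unit_mulr1 unit_mulV unit_mulrV.

End UnitGroup.

Section Center.
Variable D : divisionRingType.

(* Membership in the center is made boolean by excluded middle, so that the
   center can be a subtype. *)
Definition center_pred : {pred D} :=
  fun z => `[< forall x : D, z * x = x * z >].

Lemma center_predP z :
  reflect (forall x : D, z * x = x * z) (z \in center_pred).
Proof. exact: asboolP. Qed.

Fact center_divring_closed : divring_closed center_pred.
Proof.
split=> [|y z /center_predP yC /center_predP zC|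
         y z /center_predP yC /center_predP zC]; apply/center_predP=> x.
- by rewrite mul1r mulr1.
- by rewrite mulrBl mulrBr yC zC.
have zVC : GRing.comm x z^-1 by apply: commrV; exact: esym (zC x).
by rewrite -mulrA -zVC mulrA yC mulrA.
Qed.

HB.instance Definition _ :=
  GRing.isDivringClosed.Build D center_pred center_divring_closed.

Definition center : Type := {z : D | z \in center_pred}.

HB.instance Definition _ := [isSub of center for sval].
HB.instance Definition _ := [Choice of center by <:].
HB.instance Definition _ := [SubChoice_isSubUnitRing of center by <:].

Fact center_mulC : commutative (@GRing.mul center).
Proof. by move=> y z; apply: val_inj; exact: (center_predP _ (valP y)). Qed.

HB.instance Definition _ :=
  GRing.PzRing_hasCommutativeMul.Build center center_mulC.

Fact center_fieldP : GRing.field_axiom center.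
Proof.
by move=> z z0; apply: divring_unitP; rewrite -(inj_eq val_inj) in z0.
Qed.

HB.instance Definition _ := GRing.ComUnitRing_isField.Build center center_fieldP.

(* [D] itself, as a left vector space over its center. *)
Definition over_center : Type := D.

HB.instance Definition _ := GRing.Zmodule.on over_center.

Definition center_scale (c : center) (v : over_center) : over_center :=
  (val c : D) * v.

Fact center_scaleA a b v :
  center_scale a (center_scale b v) = center_scale (a * b) v.
Proof. exact: mulrA. Qed.
Fact center_scale1 : left_id 1 center_scale.
Proof. by move=> v; exact: mul1r. Qed.
Fact center_scaleDr : right_distributive center_scale +%R.
Proof. by move=> a u v; exact: mulrDr. Qed.
Fact center_scaleDl v : {morph center_scale^~ v : a b / a + b}.
Proof. by move=> a b; exact: mulrDl. Qed.

HB.instance Definition _ := GRing.Zmodule_isLmodule.Build center over_center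
  center_scaleA center_scale1 center_scaleDr center_scaleDl.

Definition centrally_finite : Prop :=
  exists n : nat, inhabited (Vector.axiom n over_center).

Definition annihilates (p : {poly center}) (x : D) : Prop :=
  root (map_poly val p) x.

Definition is_minimal_polynomial (x : D) (p : {poly center}) : Prop :=
  [/\ p \is monic, annihilates p x &
      forall q : {poly center}, q != 0 -> annihilates q x ->
        (size p <= size q)%N].

Definition algebraic_of_degree_at_most (d : nat) (x : D) : Prop :=
  exists2 p : {poly center}, is_minimal_polynomial x p & ((size p).-1 <= d)%N.

Definition non_central (N : set (unit_group D)) : Prop :=
  ~ (forall x, N x -> val x \in center_pred).

End Center.

Arguments center_pred D : clear implicits.

(* Main.v *)
(* Let F be the center, b a non-central element of N, and y in D. Starting from
   1 + t y with t in F and going down the series by commutators with b (normal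
   steps) and powers (finite index), one gets elements of N of the form
   1 + t (k L^e(y)) + O(t^2), where L(y) = y - b y b^-1 and k, e do not depend
   on y. Their commutators with a have bounded degree, and so has the limit
   phi(y) = k (a L^e(y) a^-1 - L^e(y)) as t -> 0: a family of fractions over
   D[t] that is F-linearly dependent for almost all t in F has dependent values
   at t = 0. Here O(t^2) and limits are algebraic, in the local ring at t = 0
   of the Ore localization of D[t].
   In characteristic 0, phi is nonzero. Differentiating the minimal polynomial
   of a value of phi of maximal degree then gives a nonzero operator
   y |-> sum_i p_i y q_i of finite rank over F, which only exists if D has
   finite dimension over F. *)
Require Import Defs.
From mathcomp Require Import all_boot all_algebra.
From mathcomp Require Import boolp cardinality.
From mathcomp Require Import classical_sets.
Set Implicit Arguments.
Unset Strict Implicit.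
Unset Printing Implicit Defensive.
Import GRing.Theory.
Local Open Scope ring_scope.

(** * Operators y |-> sum_i p_i y q_i *)

Section DivisionRingTheory.
Variable D : divisionRingType.
Local Notation F := (center D).
Implicit Types (x y z u v w : D) (t : F) (T S : D -> D).

Lemma divring_mulVr x : x != 0 -> x^-1 * x = 1.
Proof. by move=> x0; rewrite mulVr ?divring_unitP. Qed.

Lemma divring_mulrV x : x != 0 -> x * x^-1 = 1.
Proof. by move=> x0; rewrite mulrV ?divring_unitP. Qed.

Lemma divring_mulf_eq0 x y : x * y = 0 -> x = 0 \/ y = 0.
Proof.
move=> xy0; have [->|x0] := eqVneq x 0; first by left.
by right; rewrite -[y]mul1r -(divring_mulVr x0) -mulrA xy0 mulr0.
Qed.

Lemma divring_mulf_neq0 x y : x != 0 -> y != 0 -> x * y != 0.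
Proof.
move=> x0 y0; apply/eqP => /divring_mulf_eq0 [] /eqP.
  exact/negP.
exact/negP.
Qed.

Lemma centralC (c : F) x : val c * x = x * val c.
Proof. exact: (center_predP _ (valP c)). Qed.

Lemma comm_center x (c : F) : GRing.comm x (val c).
Proof. by rewrite /GRing.comm centralC. Qed.

Definition lin_dep (I : finType) (e : I -> D) : Prop :=
  exists2 f : I -> F, exists i, f i != 0 & \sum_i val (f i) * e i = 0.

Definition in_span (I : finType) (e : I -> D) x : Prop :=
  exists f : I -> F, x = \sum_i val (f i) * e i.

(** These operators form the image in End_F(D) of the tensor product over F of D with its opposite
    ring. *)
Definition mult_op T : Prop :=
  exists s : seq (D * D), forall y, T y = \sum_(c <- s) c.1 * y * c.2.

Lemma mult_op_sandwich p q : mult_op (fun y => p * y * q).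
Proof. by exists [:: (p, q)] => y; rewrite big_seq1. Qed.

Lemma mult_op_ext T S : mult_op T -> T =1 S -> mult_op S.
Proof. by move=> [s sE] TS; exists s => y; rewrite -TS. Qed.

Lemma mult_op_id : mult_op id.
Proof.
by apply: mult_op_ext (mult_op_sandwich 1 1) _ => y; rewrite mul1r mulr1.
Qed.

Lemma mult_op0 : mult_op (fun=> 0).
Proof. by exists [::] => y; rewrite big_nil. Qed.

Lemma mult_opD T S : mult_op T -> mult_op S -> mult_op (fun y => T y + S y).
Proof.
by move=> [s sE] [s' sE']; exists (s ++ s') => y; rewrite big_cat sE sE'.
Qed.

Lemma mult_op_mull p T : mult_op T -> mult_op (fun y => p * T y).
Proof.
move=> [s sE]; exists [seq (p * c.1, c.2) | c <- s] => y.
by rewrite sE big_map mulr_sumr; apply: eq_bigr => c _; rewrite !mulrA.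
Qed.

Lemma mult_op_mulr p T : mult_op T -> mult_op (fun y => T y * p).
Proof.
move=> [s sE]; exists [seq (c.1, c.2 * p) | c <- s] => y.
by rewrite sE big_map mulr_suml; apply: eq_bigr => c _; rewrite !mulrA.
Qed.

Lemma mult_opB T S : mult_op T -> mult_op S -> mult_op (fun y => T y - S y).
Proof.
move=> hT hS; apply: mult_op_ext (mult_opD hT (mult_op_mull (-1) hS)) _ => y.
by rewrite mulN1r.
Qed.

Lemma mult_op_sum (I : Type) (r : seq I) (T : I -> D -> D) :
  (forall i, mult_op (T i)) -> mult_op (fun y => \sum_(i <- r) T i y).
Proof.
move=> hT; elim: r => [|i r IHr].
  by apply: mult_op_ext mult_op0 _ => y; rewrite big_nil.
by apply: mult_op_ext (mult_opD (hT i) IHr) _ => y; rewrite big_cons.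
Qed.

Lemma mult_op_comp T S : mult_op T -> mult_op S -> mult_op (T \o S).
Proof.
move=> [s sE] hS.
apply: (@mult_op_ext (fun y => \sum_(c <- s) c.1 * S y * c.2)); last first.
  by move=> y /=; rewrite sE.
by apply: mult_op_sum => c; apply/mult_op_mulr/mult_op_mull.
Qed.

Lemma mult_op_iter T n : mult_op T -> mult_op (iter n T).
Proof.
move=> hT; elim: n => [|n IHn]; first exact: mult_op_id.
exact: mult_op_comp hT IHn.
Qed.

Lemma mult_opDr T : mult_op T -> forall x y, T (x + y) = T x + T y.
Proof.
move=> [s sE] x y; rewrite !sE -big_split; apply: eq_bigr => c _ /=.
by rewrite mulrDr mulrDl.
Qed.

Lemma mult_op0r T : mult_op T -> T 0 = 0.
Proof. by move=> [s ->]; rewrite big1 // => c _; rewrite mulr0 mul0r. Qed.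

Lemma mult_opBr T : mult_op T -> forall x y, T (x - y) = T x - T y.
Proof.
by move=> opT x y; apply/eqP; rewrite eq_sym subr_eq -(mult_opDr opT) subrK.
Qed.

Lemma mult_opZ T : mult_op T -> forall (c : F) y, T (val c * y) = val c * T y.
Proof.
move=> [s sE] c y; rewrite !sE mulr_sumr; apply: eq_bigr => e _ /=.
by rewrite !mulrA -centralC.
Qed.

Lemma mult_op_natr T n y : mult_op T -> T (n%:R * y) = n%:R * T y.
Proof.
move=> opT; have := mult_opZ opT n%:R y.
by rewrite rmorph_nat.
Qed.

Lemma mult_op_lin_sum T (I : finType) (f : I -> F) (e : I -> D) : mult_op T ->
  T (\sum_i val (f i) * e i) = \sum_i val (f i) * T (e i).
Proof.
move=> hT.
rewrite (big_morph T (mult_opDr hT) (mult_op0r hT)).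
by apply: eq_bigr => i _; rewrite mult_opZ.
Qed.

Lemma sum_delta_l (I : finType) (i : I) (G : I -> D) :
  \sum_j (j == i)%:R * G j = G i.
Proof.
rewrite (bigD1 i) //= eqxx mul1r big1 ?addr0 // => j /negPf ->.
by rewrite mul0r.
Qed.

Lemma sum_delta_r (I : finType) (i : I) (G : I -> D) :
  \sum_j G j * (i == j)%:R = G i.
Proof.
rewrite (bigD1 i) //= eqxx mulr1 big1 ?addr0 // => j ji.
by rewrite eq_sym (negPf ji) mulr0.
Qed.

(* Density of the multiplication ring of D in End_F(D). If every
   operator killing the other vectors kills e 0, the values tau_i = T_i (e 0)
   of the dual family of those vectors are central, by comparing the operators
   T_k and T_k c, and e 0 = sum tau_i e_i. *)
Lemma dual_family n (e : 'I_n -> D) : ~ lin_dep e ->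
  exists T : 'I_n -> D -> D,
    (forall i, mult_op (T i)) /\ forall i j, T i (e j) = (i == j)%:R.
Proof.
elim: n e => [|n IHn] e free_e.
  by exists (fun _ => id); split=> [i|[]//]; exact: mult_op_id.
pose e' i := e (lift ord0 i).
have [|T' [opT' T'E]] := IHn e'.
  move=> [f [i fi] fe]; apply: free_e.
  exists (fun k => if unlift ord0 k is Some j then f j else 0).
    by exists (lift ord0 i); rewrite liftK.
  rewrite big_ord_recl unlift_none mul0r add0r -[RHS]fe.
  by apply: eq_bigr => j _; rewrite liftK.
have [S [opS Se' Se]] : exists S,
    [/\ mult_op S, forall j, S (e' j) = 0 & S (e ord0) != 0].
  apply: contrapT => noS; apply: free_e.
  (* Subtracting from [S] its interpolation at the [e' i] leaves an operator killing all of them,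
     which by assumption also kills [e ord0]. *)
  have S_E S : mult_op S -> S (e ord0) = \sum_i S (e' i) * T' i (e ord0).
    move=> opS.
    apply/eqP; rewrite -subr_eq0; apply/negPn/negP => /negP ne0; apply: noS.
    exists (fun z => S z - \sum_i S (e' i) * T' i z); split.
    - apply: (mult_opB opS); apply: mult_op_sum => i; exact: mult_op_mull.
    - move=> j; rewrite (eq_bigr (fun i => S (e' i) * (j == i)%:R)).
        by rewrite sum_delta_r subrr.
      by move=> i _; rewrite T'E eq_sym.
    - exact/negP.
  have tauC k : T' k (e ord0) \in center_pred D.
    apply/center_predP => c.
    rewrite (S_E (fun z => T' k z * c)); last exact: mult_op_mulr.
    rewrite (eq_bigr (fun i => (i == k)%:R * (c * T' i (e ord0)))).
      by rewrite sum_delta_l.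
    move=> i _; rewrite T'E eq_sym; case: (i == k).
      by rewrite !mul1r.
    by rewrite !mul0r.
  pose tau k : F := exist (fun z => z \in center_pred D) _ (tauC k).
  exists (fun k => if unlift ord0 k is Some j then tau j else -1).
    exists ord0; rewrite unlift_none oppr_eq0; exact: oner_neq0.
  rewrite big_ord_recl unlift_none mulN1r (S_E id mult_op_id) addrC.
  apply/eqP; rewrite subr_eq0; apply/eqP/eq_bigr => i _.
  by rewrite liftK centralC.
pose T0 z := (S (e ord0))^-1 * S z.
have opT0 : mult_op T0 by exact: mult_op_mull.
have T0E j : T0 (e j) = (ord0 == j)%:R.
  case: (unliftP ord0 j) => [i|] ->; rewrite /T0.
    by rewrite Se' mulr0.
  by rewrite divring_mulVr.
(* The multiple of [T0] makes [T' j] vanish at [e ord0] without changing its values at the [e']. *)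
exists (fun k => if unlift ord0 k is Some j
                 then fun z => T' j z - T' j (e ord0) * T0 z else T0); split.
  move=> k; case: (unlift ord0 k) => [j|//].
  by apply: mult_opB (opT' j) _; exact: mult_op_mull.
move=> i j; case: (unliftP ord0 i) => [i'|] -> //.
case: (unliftP ord0 j) => [j'|] ->.
  by rewrite T0E mulr0 subr0 T'E (inj_eq lift_inj).
by rewrite T0E eqxx mulr1 subrr.
Qed.

(** Redundant vectors are discarded by induction on [n]. Coordinates in a free family are unique,
    hence linear, and identify D with row vectors over F. *)
Lemma centrally_finite_of_span n (e : 'I_n -> D) :
  (forall x, in_span e x) -> centrally_finite D.
Proof.
elim: n e => [|n IHn] e span_e.
  have [f /eqP] := span_e 1.
  by rewrite big_ord0 oner_eq0.
have [[f [i fi] fe]|free_e] := pselect (lin_dep e).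
  have splitE (G : 'I_n.+1 -> D) : \sum_j G j = G i + \sum_(j < n) G (lift i j).
    by rewrite (bigD1_ord i).
  apply: (IHn (fun j => e (lift i j))) => x.
  have [g ->] := span_e x.
  have ei : e i = \sum_j val (- (f i)^-1 * f (lift i j)) * e (lift i j).
    move: fe; rewrite splitE => /eqP; rewrite addr_eq0 => /eqP fe.
    transitivity (val (f i)^-1 * (val (f i) * e i)).
      by rewrite mulrA -rmorphM mulVf // rmorph1 mul1r.
    rewrite fe mulrN -mulNr mulr_sumr.
    by apply: eq_bigr => j _; rewrite mulrA -rmorphN -rmorphM.
  exists (fun j => g (lift i j) + g i * (- (f i)^-1 * f (lift i j))).
  rewrite splitE ei mulr_sumr -big_split /=; apply: eq_bigr => j _.
  by rewrite [RHS]mulrDl addrC !mulrA.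
have [coord coordE] := choice span_e.
have uniq_coord (f g : 'I_n.+1 -> F) :
    \sum_i val (f i) * e i = \sum_i val (g i) * e i -> forall i, f i = g i.
  move=> fg i; apply: contrapT => /eqP; rewrite -subr_eq0 => fgi.
  apply: free_e; exists (fun j => f j - g j); first by exists i.
  apply/eqP; rewrite (eq_bigr (fun i => val (f i) * e i - val (g i) * e i)).
    by rewrite sumrB fg subrr.
  by move=> j _; rewrite -mulrBl -rmorphB.
exists n.+1; constructor.
exists (fun x : over_center D => \row_i coord x i).
  move=> c x y; apply/rowP => i; rewrite !mxE.
  apply: (uniq_coord (coord (c *: x + y)) (fun i => c * coord x i + coord y i)).
  rewrite -coordE.
  rewrite (eq_bigr (fun i => val c * (val (coord x i) * e i) +
                             val (coord y i) * e i)).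
    by rewrite big_split -mulr_sumr -!coordE.
  by move=> j _; rewrite mulrA -rmorphM -mulrDl -rmorphD.
exists (fun r : 'rV[F]_n.+1 => \sum_i val (r ord0 i) * e i).
  by move=> x; rewrite [RHS]coordE; apply: eq_bigr => i _; rewrite mxE.
move=> r; apply/rowP => i; rewrite mxE.
by apply: (uniq_coord _ (fun i => r ord0 i)); rewrite -coordE.
Qed.

(* Commuting T with left multiplications shortens T = sum p_i y q_i once
   p_1 = 1. If all these commutators vanish, then T is the right multiplication
   by T 1, which has finite rank only if D has finite dimension. *)
Lemma centrally_finite_of_finite_rank T y0 (I : finType) (e : I -> D) :
  mult_op T -> T y0 != 0 -> (forall y, in_span e (T y)) -> centrally_finite D.
Proof.
move=> [s sE]; have [n] := ubnP (size s).
elim: n T y0 I e s sE => // n IHn T y0 I e s sE.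
case: s sE => [|[p q] s] sE.
  by rewrite sE big_nil eqxx.
rewrite ltnS /= => s_n Ty0 Te.
have [p0|p0] := eqVneq p 0.
  apply: (IHn T y0 I e s) => // y.
  by rewrite sE big_cons p0 !mul0r add0r.
pose T1 y := p^-1 * T y.
have T1E y : T1 y = y * q + \sum_(c <- s) (p^-1 * c.1) * y * c.2.
  rewrite /T1 sE big_cons mulrDr !mulrA divring_mulVr // mul1r mulr_sumr.
  by congr (_ + _); apply: eq_bigr => c _; rewrite !mulrA.
have T1y0 : T1 y0 != 0 by rewrite divring_mulf_neq0 // invr_eq0.
pose e1 i := p^-1 * e i.
have T1e y : in_span e1 (T1 y).
  have [f fE] := Te y; exists f; rewrite /T1 fE mulr_sumr.
  by apply: eq_bigr => i _; rewrite !mulrA centralC.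
have [[d [y1 dy1]]|comm_T1] :=
    pselect (exists d y, T1 (d * y) - d * T1 y != 0).
  (* The commutator cancels the term [y * q], so the sum gets shorter, and its values stay in the
     span of the [e1 i] and [d * e1 i]. *)
  pose e2 (i : I + I) := match i with inl i => e1 i | inr i => d * e1 i end.
  apply: (IHn (fun y => T1 (d * y) - d * T1 y) y1 (I + I)%type e2
            [seq (p^-1 * c.1 * d - d * (p^-1 * c.1), c.2) | c <- s]) => //.
  - move=> y; rewrite !T1E big_map mulrDr mulr_sumr.
    rewrite opprD addrACA mulrA subrr add0r.
    rewrite -sumrB; apply: eq_bigr => c _.
    by rewrite /= !mulrBl !mulrA.
  - by rewrite size_map.
  - move=> y; have [f ->] := T1e (d * y); have [g ->] := T1e y.
    exists (fun i => match i with inl i => f i | inr i => - g i end).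
    rewrite big_sumType /= mulr_sumr -sumrN; congr (_ + _).
    apply: eq_bigr => i _.
    by by by rewrite mulrA -(centralC (g i)) -mulrA -mulNr.
have T1r y : T1 y = y * T1 1.
  apply/eqP; rewrite -subr_eq0; apply/negPn/negP => Ty; apply: comm_T1.
  by exists y, 1; rewrite mulr1.
have T10 : T1 1 != 0.
  by apply: contraNneq T1y0 => T10; rewrite T1r T10 mulr0.
apply: (@centrally_finite_of_span #|I| (fun i => e1 (enum_val i) * (T1 1)^-1)).
move=> x; have [f fE] := T1e x.
exists (fun i => f (enum_val i)).
transitivity (T1 x * (T1 1)^-1).
  by rewrite T1r -mulrA divring_mulrV ?mulr1.
rewrite fE mulr_suml.
rewrite (reindex (@enum_val I I)); last exact: onW_bij (@enum_val_bij I).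
by apply: eq_bigr => i _; rewrite -mulrA.
Qed.

End DivisionRingTheory.

(** * Fractions over D[t] regular at t = 0 *)

Section Regular.
Variable D : divisionRingType.
Local Notation F := (center D).
Implicit Types (p q : {poly D}) (t : F) (s : F -> D) (x y c : D).

(** Cofiniteness, given by a list of exceptions. Such sets are nonempty once F is infinite, see
    [almost_all_ex]. *)
Definition almost_all (P : F -> Prop) : Prop :=
  exists l : seq F, forall t, t \notin l -> P t.

Lemma almost_all_imp (P Q : F -> Prop) :
  (forall t, P t -> Q t) -> almost_all P -> almost_all Q.
Proof. by move=> PQ [l lP]; exists l => t /lP; exact: PQ. Qed.

Lemma almost_allT (P : F -> Prop) : (forall t, P t) -> almost_all P.
Proof. by move=> hP; exists [::]. Qed.

Lemma almost_all_and (P Q : F -> Prop) :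
  almost_all P -> almost_all Q -> almost_all (fun t => P t /\ Q t).
Proof.
move=> [l lP] [l' lQ]; exists (l ++ l') => t.
by rewrite mem_cat negb_or => /andP[/lP ? /lQ].
Qed.

Lemma almost_all_neq t0 : almost_all (fun t => t != t0).
Proof. by exists [:: t0] => t; rewrite inE. Qed.

(** Evaluation respects products at points commuting with the coefficients; hence the restriction to
    central parameters. *)
Lemma hornerM_center p q t : (p * q).[val t] = p.[val t] * q.[val t].
Proof. by rewrite hornerM_comm // /comm_poly centralC. Qed.

Lemma horner_exp_center p n t : (p ^+ n).[val t] = p.[val t] ^+ n.
Proof. by rewrite horner_exp_comm // /comm_poly centralC. Qed.

(** Each central root splits off a linear factor, so induction on the size bounds their number. *)
Lemma almost_all_nonroot p : p != 0 -> almost_all (fun t => p.[val t] != 0).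
Proof.
have [n] := ubnP (size p); elim: n p => // n IHn p.
rewrite ltnS => p_n p0.
have [[t0 pt0]|no_root] := pselect (exists t, p.[val t] = 0); last first.
  apply: almost_allT => t; apply/eqP => pt; apply: no_root; by exists t.
have /factor_theorem [q pq] : root p (val t0) by apply/eqP.
have q0 : q != 0 by apply: contraNneq p0 => q0; rewrite pq q0 mul0r.
have q_n : (size q < n)%N.
  by move: p_n; rewrite pq size_Mmonic ?monicXsubC // size_XsubC addn2.
have := almost_all_and (almost_all_neq t0) (IHn _ q_n q0).
apply: almost_all_imp => t [tt0 qt].
rewrite pq hornerM_center !hornerE divring_mulf_neq0 //.
by rewrite -rmorphB raddf_eq0 ?subr_eq0 //; exact: val_inj.
Qed.

Lemma poly_mulf_neq0 p q : p != 0 -> q != 0 -> p * q != 0.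
Proof.
move=> p0 q0; rewrite -lead_coef_eq0 lead_coef_proper_mul.
  by rewrite divring_mulf_neq0 ?lead_coef_eq0.
by rewrite divring_mulf_neq0 ?lead_coef_eq0.
Qed.

(** * Division and the right Ore condition in D[t] *)

Lemma poly_left_div p q : q != 0 ->
  exists d r, p = q * d + r /\ (size r < size q)%N.
Proof.
move=> q0; have [n] := ubnP (size p); elim: n p => // n IHn p.
rewrite ltnS => p_n.
have [pq|qp] := ltnP (size p) (size q).
  by exists 0, p; rewrite mulr0 add0r.
have [p0|p0] := eqVneq p 0.
  by exists 0, 0; rewrite p0 mulr0 addr0 size_poly0 size_poly_gt0.
pose a := ((lead_coef q)^-1 * lead_coef p)%:P * 'X^(size p - size q).
have lq : lead_coef q != 0 by rewrite lead_coef_eq0.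
have [|d [r [pE r_q]]] := IHn (p - q * a).
  apply: leq_trans p_n.
  rewrite -(prednK (_ : 0 < size p)%N) ?size_poly_gt0 // ltnS.
  apply/leq_sizeP => j; rewrite leq_eqVlt => /predU1P[<-|].
    rewrite coefB /a mulrA coefMXn.
    have -> : ((size p).-1 < size p - size q)%N = false.
      apply/negbTE; rewrite -leqNgt leq_subLR addnC.
      rewrite -ltnS -addSn prednK ?size_poly_gt0 //.
      by rewrite -[X in (X < _)%N]addn0 ltn_add2l size_poly_gt0.
    have -> : ((size p).-1 - (size p - size q) = (size q).-1)%N.
      by rewrite -subn1 -subnDA addnC subnDA subKn // subn1.
    by rewrite coefMC mulrA -/(lead_coef q) divring_mulrV // mul1r subrr.
  move=> pj; rewrite coefB /a mulrA coefMXn.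
  have p_j : (size p <= j)%N.
    by rewrite -(prednK (_ : 0 < size p)%N) ?size_poly_gt0.
  rewrite (nth_default _ p_j) sub0r; case: ifP => _; first by rewrite oppr0.
  rewrite coefMC nth_default ?mul0r ?oppr0 //.
  by rewrite leq_subRL ?(leq_trans (leq_subr _ _)) // addnC subnKC // leqW.
exists (a + d), r; split=> //.
by rewrite mulrDr -addrA -pE addrC subrK.
Qed.

(** Euclid's algorithm: if p = q d + r and q q1 = r p1, then p p1 = q (d p1 + q1). *)
Lemma poly_right_ore p q : q != 0 ->
  exists p' q', q' != 0 /\ p * q' = q * p'.
Proof.
have [n] := ubnP (size q); elim: n p q => // n IHn p q.
rewrite ltnS => q_n q0.
have [d [r [pE r_q]]] := poly_left_div p q0.
have [r0|r0] := eqVneq r 0.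
  by exists d, 1; rewrite oner_neq0 mulr1 pE r0 addr0.
have [p1 [q1 [q10 qr]]] := IHn q r (leq_trans r_q q_n) r0.
exists (d * p1 + q1), p1; split.
  apply: contraTneq (poly_mulf_neq0 q0 q10) => p10.
  by rewrite qr p10 mulr0 eqxx.
by rewrite pE mulrDl mulrDr -mulrA qr.
Qed.

Lemma poly_divX p : p`_0 = 0 -> exists2 q, p = q * 'X & q`_0 = p`_1.
Proof.
move=> p0; exists (drop_poly 1 p); last by rewrite coef_drop_poly.
rewrite -{1}(poly_take_drop 1 p) expr1 (_ : take_poly 1 p = 0) ?add0r //.
by apply/polyP => -[|i]; rewrite coef_take_poly ?coef0.
Qed.

(** The Ore condition for denominators equal to 1 at t = 0. If [q'] vanishes at 0, so does [p'], and
    a factor X cancels; in the end a constant factor on the right normalizes [q']. *)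
Lemma poly_right_ore1 p q : q`_0 = 1 ->
  exists p' q', [/\ q'`_0 = 1, p'`_0 = p`_0 & p * q' = q * p'].
Proof.
move=> q1.
have q0 : q != 0.
  by apply/eqP => q0; move/eqP: q1; rewrite q0 coef0 eq_sym oner_eq0.
have [p' [q' [q'0]]] := poly_right_ore p q0.
have [n] := ubnP (size q'); elim: n p' q' q'0 => // n IHn p' q' q'0.
rewrite ltnS => q'_n pq.
have pq0 : p`_0 * q'`_0 = p'`_0 by rewrite -coef0M pq coef0M q1 mul1r.
have [q'00|q'00] := eqVneq q'`_0 0.
  have [q2 q2E _] := poly_divX q'00.
  have [|p2 p2E _] := @poly_divX p'; first by rewrite -pq0 q'00 mulr0.
  have q20 : q2 != 0 by apply: contraNneq q'0 => q20; rewrite q2E q20 mul0r.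
  apply: (IHn p2 q2) => //.
    by move: q'_n; rewrite q2E size_mulX.
  apply: (monic_rreg (monicX D)) => /=.
  by rewrite -!mulrA -q2E -p2E.
exists (p' * (q'`_0)^-1%:P), (q' * (q'`_0)^-1%:P).
split; rewrite ?coefMC ?divring_mulrV //.
  by rewrite -pq0 -mulrA divring_mulrV ?mulr1.
by rewrite !mulrA pq.
Qed.

(* Functions of a central parameter t that agree for almost all t with
   a fraction p(t) q(t)^-1 over D[t] defined at t = 0, where it equals c. *)
Definition regular s c : Prop :=
  exists p q, [/\ p`_0 = c, q`_0 = 1 &
                  almost_all (fun t => s t * q.[val t] = p.[val t])].

Lemma regular_ext s s' c :
  regular s c -> almost_all (fun t => s t = s' t) -> regular s' c.
Proof.
move=> [p [q [pc q1 spq]]] ss'; exists p, q; split=> //.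
by apply: almost_all_imp (almost_all_and spq ss') => t [+ <-].
Qed.

Lemma regular_poly p : regular (fun t => p.[val t]) p`_0.
Proof.
exists p, 1; split=> //; first by rewrite coef1.
by apply: almost_allT => t; rewrite hornerE mulr1.
Qed.

Lemma regular_cst c : regular (fun=> c) c.
Proof.
have := regular_poly c%:P; rewrite coefC => /regular_ext; apply.
by apply: almost_allT => t; rewrite hornerC.
Qed.

Lemma regular_param : regular (fun t => val t) 0.
Proof.
have := regular_poly 'X; rewrite coefX => /regular_ext; apply.
by apply: almost_allT => t; rewrite hornerX.
Qed.

Lemma regularD s s' c c' :
  regular s c -> regular s' c' -> regular (fun t => s t + s' t) (c + c').
Proof.
move=> [p [q [<- q1 spq]]] [p' [q' [<- q'1 spq']]].
(* The common denominator is q a = q' b. *)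
have [b [a [a1 b1 ab]]] := poly_right_ore1 q q'1.
exists (p * a + p' * b), (q * a); split.
- by rewrite coefD !coef0M a1 b1 q1 !mulr1.
- by rewrite coef0M q1 a1 mulr1.
apply: almost_all_imp (almost_all_and spq spq') => t [pt p't].
rewrite mulrDl hornerD !hornerM_center mulrA pt; congr (_ + _).
by rewrite -hornerM_center ab hornerM_center mulrA p't.
Qed.

Lemma regularM s s' c c' :
  regular s c -> regular s' c' -> regular (fun t => s t * s' t) (c * c').
Proof.
move=> [p [q [<- q1 spq]]] [p' [q' [<- q'1 spq']]].
have [b [a [a1 b1 ab]]] := poly_right_ore1 p' q1.
exists (p * b), (q' * a); split.
- by rewrite coef0M b1.
- by rewrite coef0M q'1 a1 mulr1.
apply: almost_all_imp (almost_all_and spq spq') => t [pt p't].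
rewrite !hornerM_center -mulrA [s' t * _]mulrA p't.
by rewrite -(hornerM_center p') ab hornerM_center mulrA pt.
Qed.

Lemma regularN s c : regular s c -> regular (fun t => - s t) (- c).
Proof.
move=> sc; have := regularM (regular_cst (-1)) sc; rewrite mulN1r.
by move/regular_ext; apply; apply: almost_allT => t; rewrite mulN1r.
Qed.

Lemma regularB s s' c c' :
  regular s c -> regular s' c' -> regular (fun t => s t - s' t) (c - c').
Proof. by move=> sc s'c'; apply: regularD sc (regularN s'c'). Qed.

Lemma regularX s c n : regular s c -> regular (fun t => s t ^+ n) (c ^+ n).
Proof.
move=> sc; elim: n => [|n IHn]; first exact: regular_cst.
rewrite exprS; apply: regular_ext (regularM sc IHn) _.
by apply: almost_allT => t; rewrite exprS.
Qed.

Lemma regular_mult_op T s c :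
  mult_op T -> regular s c -> regular (fun t => T (s t)) (T c).
Proof.
move=> [r rE] sc; rewrite rE.
apply: (@regular_ext (fun t => \sum_(x <- r) x.1 * s t * x.2)); last first.
  by apply: almost_allT => t; rewrite rE.
elim: r {rE} => [|x r IHr].
  rewrite big_nil; apply: regular_ext (regular_cst 0) _.
  by apply: almost_allT => t; rewrite big_nil.
rewrite big_cons.
have sx := regularM (regularM (regular_cst x.1) sc) (regular_cst x.2).
apply: regular_ext (regularD sx IHr) _.
by apply: almost_allT => t; rewrite big_cons.
Qed.

Lemma regular_neq0 s c :
  regular s c -> c != 0 -> almost_all (fun t => s t != 0).
Proof.
move=> [p [q [<- q1 spq]]] p0.
have {}p0 : p != 0 by apply: contraNneq p0 => ->; rewrite coef0.
apply: almost_all_imp (almost_all_and spq (almost_all_nonroot p0)) => t [pt].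
by apply: contraNneq => s0; rewrite -pt s0 mul0r.
Qed.

(** With value 1, the numerator is itself an admissible denominator. *)
Lemma regularV s : regular s 1 -> regular (fun t => (s t)^-1) 1.
Proof.
move=> s1; have s0 := regular_neq0 s1 (oner_neq0 D).
case: s1 => p [q [p1 q1 spq]]; exists q, p; split=> //.
apply: almost_all_imp (almost_all_and spq s0) => t [<- st0].
by rewrite mulrA divring_mulVr // mul1r.
Qed.

(* Gaussian elimination: the pivot has value 1 at t = 0. *)
Lemma regular_kernel n (M : 'I_n -> 'I_n -> F -> D) :
  (forall i j, regular (M i j) (i == j)%:R) ->
  almost_all (fun t => forall f : 'I_n -> D,
    (forall i, \sum_j M i j t * f j = 0) -> forall j, f j = 0).
Proof.
elim: n M => [|n IHn] M regM; first by apply: almost_allT => t f _ [].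
(* The Schur complement of the pivot; its correction term vanishes at t = 0, so its value there is
   again the identity. *)
pose M' i j t := M (lift ord0 i) (lift ord0 j) t -
  M (lift ord0 i) ord0 t * (M ord0 ord0 t)^-1 * M ord0 (lift ord0 j) t.
have regM' i j : regular (M' i j) (i == j)%:R.
  rewrite -[_%:R]subr0 -[X in _ - X](mulr0 (0 * 1)).
  apply: regularB; first by have := regM (lift ord0 i) (lift ord0 j).
  apply: regularM (regularM _ (regularV _)) _.
  - exact: regM (lift ord0 i) ord0.
  - exact: regM ord0 ord0.
  - exact: regM ord0 (lift ord0 j).
have M00 := regular_neq0 (regM ord0 ord0) (oner_neq0 D).
apply: almost_all_imp (almost_all_and M00 (IHn M' regM')) => t [M0 kerM'] f Mf.
have f0 : f ord0 = - ((M ord0 ord0 t)^-1 *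
                      \sum_j M ord0 (lift ord0 j) t * f (lift ord0 j)).
  have := Mf ord0; rewrite big_ord_recl => /eqP; rewrite addr_eq0 => /eqP fE.
  by rewrite -mulrN -[- _]opprK -fE opprK mulrA divring_mulVr // mul1r.
have fl : forall j, f (lift ord0 j) = 0.
  apply: (kerM' (fun j => f (lift ord0 j))) => i.
  rewrite -[RHS](Mf (lift ord0 i)) big_ord_recl f0 mulrN mulrA mulr_sumr.
  rewrite -sumrN -big_split; apply: eq_bigr => j _ /=.
  by rewrite /M' mulrBl !mulrA addrC.
move=> j; case: (unliftP ord0 j) => [i|] -> //.
by rewrite f0 big1 ?mulr0 ?oppr0 // => i _; rewrite fl mulr0.
Qed.

Hypothesis char0 : [pchar D] =i pred0.

Lemma natr_center_neq0 n : n.+1%:R != 0 :> F.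
Proof.
have /pcharf0P -> // : [pchar F] =i pred0.
move=> r; rewrite -(char0 r) !inE; congr (_ && _).
by rewrite -(inj_eq val_inj) rmorph_nat.
Qed.

(** In characteristic 0 the natural numbers are distinct in F, so no finite list contains them
    all. *)
Lemma almost_all_ex (P : F -> Prop) : almost_all P -> exists t, P t.
Proof.
move=> [l lP]; apply: contrapT => noP.
have l_all n : n%:R \in l.
  by apply/negPn/negP => /lP Pn; apply: noP; exists n%:R.
have uniq_nat : uniq [seq n%:R : F | n <- iota 0 (size l).+1].
  rewrite map_inj_in_uniq ?iota_uniq // => m n _ _.
  wlog mn : m n / (m <= n)%N.
    by move=> wl mn; case/orP: (leq_total m n) => /wl ->.
  rewrite -(subnK mn) natrD -[X in X = _]add0r => /addIr.
  case: (n - m)%N => // k /esym k0.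
  by have := natr_center_neq0 k; rewrite k0 eqxx.
have : (size [seq n%:R : F | n <- iota 0 (size l).+1] <= size l)%N.
  by apply: uniq_leq_size => // x /mapP[n _ ->].
by rewrite size_map size_iota ltnn.
Qed.

(** If [e] were free, a dual family [T] would give a matrix [T i (s j t)] equal to the identity at t
    = 0. For almost all t its kernel is trivial, yet it contains the coefficients of a dependence of
    the [s j t]. *)
Lemma lin_dep_limit n (s : 'I_n -> F -> D) (e : 'I_n -> D) :
  (forall i, regular (s i) (e i)) ->
  almost_all (fun t => lin_dep (fun i => s i t)) -> lin_dep e.
Proof.
move=> se s_dep; apply: contrapT => /dual_family [T [opT TE]].
have := @regular_kernel n (fun i j t => T i (s j t)).
case=> [i j|l kerT]; first by rewrite -TE; exact: regular_mult_op.
have [t [[f [i fi] fs] ker_t]] := almost_all_ex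
    (almost_all_and s_dep (ex_intro _ l kerT : almost_all _)).
case/eqP: fi; apply: val_inj; apply: (ker_t (fun j => val (f j))) => k.
rewrite (eq_bigr (fun j => val (f j) * T k (s j t))).
  by rewrite -(mult_op_lin_sum _ _ (opT k)) fs (mult_op0r (opT k)).
by move=> j _; rewrite centralC.
Qed.
End Regular.

(** * Algebraic elements of bounded degree *)

Section BoundedDegree.
Variable D : divisionRingType.
Local Notation F := (center D).
Implicit Types (t : F) (x y u v w : D).

(** Without minimality, the bound is a linear dependence of 1, x, ..., x^d, a condition that passes
    to limits. *)
Definition alg_deg d x : Prop :=
  exists f : {poly F}, [/\ f != 0, (size f <= d.+1)%N & annihilates f x].

Lemma alg_deg_of_minimal d x : algebraic_of_degree_at_most d x -> alg_deg d x.
Proof.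
move=> [f [f_monic fx _] f_d]; exists f; split=> //; first exact: monic_neq0.
by apply: leq_trans (leqSpred _) _.
Qed.

Lemma annihilatesE n (f : {poly F}) x : (size f <= n)%N ->
  annihilates f x <-> \sum_(i < n) val f`_i * x ^+ i = 0.
Proof.
move=> f_n; rewrite /annihilates /root (horner_coef_wide (n := n)); last first.
  by rewrite size_map_inj_poly //; exact: val_inj.
rewrite (eq_bigr (fun i : 'I_n => val f`_i * x ^+ i)).
  by split=> /eqP.
by move=> i _; rewrite coef_map.
Qed.

Lemma alg_deg_lin_dep d x :
  alg_deg d x <-> lin_dep (fun i : 'I_d.+1 => x ^+ i).
Proof.
split=> [[f [f0 f_d /(annihilatesE _ f_d) fx]]|[f [i fi] fx]].
  exists (fun i : 'I_d.+1 => f`_i) => //; apply: contrapT => f_0.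
  case/eqP: f0; apply/polyP => i; rewrite coef0.
  have [i_d|d_i] := ltnP i d.+1; last by rewrite nth_default // (leq_trans f_d).
  by apply/eqP/negPn/negP => fi; apply: f_0; exists (Ordinal i_d).
have fE (j : 'I_d.+1) : (\poly_(k < d.+1) f (inord k))`_j = f j.
  by rewrite coef_poly ltn_ord inord_val.
exists (\poly_(k < d.+1) f (inord k)); split.
- by apply: contraNneq fi => f0; rewrite -fE f0 coef0.
- exact: size_poly.
- apply/(annihilatesE _ (size_poly _ _)); rewrite -[RHS]fx.
  by apply: eq_bigr => j _; rewrite fE.
Qed.

Lemma annihilates_comp_affine (f : {poly F}) t (a : F) v :
  annihilates f (val a + val t * v) ->
  annihilates (f \Po (t *: 'X + a%:P)) v.
Proof.
have com x : commr_rmorph (val : F -> D) x by move=> c; exact: comm_center.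
pose ev x : {rmorphism {poly F} -> D} := horner_morph (com x).
have evC x (c : F) : ev x c%:P = val c by exact: horner_morphC.
have evX x : ev x 'X = x by exact: horner_morphX.
rewrite /annihilates /root => /eqP fv; apply/eqP; rewrite -[RHS]fv.
change (ev v (f \Po (t *: 'X + a%:P)) = ev (val a + val t * v) f).
rewrite comp_polyE rmorph_sum -[in RHS](coefK f) poly_def rmorph_sum.
apply: eq_bigr => i _; rewrite -!mul_polyC !rmorphM !rmorphXn rmorphD rmorphM.
by rewrite !evC !evX addrC.
Qed.

(** Transfers the degree bound from 1 + t v to v. *)
Lemma alg_deg_affine d t (a : F) v :
  t != 0 -> alg_deg d (val a + val t * v) -> alg_deg d v.
Proof.
move=> t0 [f [f0 f_d fv]].
have size2 : size (t *: 'X + a%:P) = 2%N.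
  by rewrite size_polyDl size_scale // size_polyX // size_polyC; case: eqP.
exists (f \Po (t *: 'X + a%:P)); split.
- by rewrite comp_poly2_eq0.
- by rewrite size_comp_poly2.
- exact: annihilates_comp_affine.
Qed.

Lemma not_alg_deg0 x : ~ alg_deg 0 x.
Proof.
move=> /alg_deg_lin_dep [f [i fi]]; rewrite big_ord1 expr0 mulr1 => f0.
by case/eqP: fi; apply: val_inj; rewrite ord1 f0.
Qed.

Lemma alg_degS_zero d : alg_deg d.+1 0.
Proof.
exists 'X; split; first by rewrite polyX_eq0.
  by rewrite size_polyX.
by rewrite /annihilates map_polyX rootX.
Qed.

Lemma lin_dep_span n (e : 'I_n.+1 -> D) :
  lin_dep e -> ~ lin_dep (fun i => e (lift ord0 i)) ->
  in_span (fun i => e (lift ord0 i)) (e ord0).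
Proof.
move=> [f [i fi]]; rewrite big_ord_recl => fe free_e.
have [f0|f0] := eqVneq (f ord0) 0.
  case: free_e; exists (fun j => f (lift ord0 j)).
    case: (unliftP ord0 i) fi => [j|] ->; first by exists j.
    by rewrite f0 eqxx.
  by move: fe; rewrite f0 mul0r add0r.
exists (fun j => - (f ord0)^-1 * f (lift ord0 j)).
transitivity (val (f ord0)^-1 * (val (f ord0) * e ord0)).
  by rewrite mulrA -rmorphM mulVf // rmorph1 mul1r.
move/eqP: fe; rewrite addr_eq0 => /eqP ->.
rewrite mulrN -mulNr mulr_sumr.
by apply: eq_bigr => j _; rewrite mulrA -rmorphN -rmorphM.
Qed.

(** In a power of v + w X, the coefficient of X is the derivative of that power at v in the
    direction w. *)
Definition line v w : {poly D} := v%:P + w%:P * 'X.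

Lemma coef0_line v w : (line v w)`_0 = v.
Proof. by rewrite coefD coefC coefMX addr0. Qed.

Lemma coef0_line_exp v w n : (line v w ^+ n)`_0 = v ^+ n.
Proof.
elim: n => [|n IHn]; first by rewrite !expr0 coef1.
by rewrite !exprS coef0M IHn coef0_line.
Qed.

Lemma coef1_line_exp v w n :
  (line v w ^+ n.+1)`_1 = v * (line v w ^+ n)`_1 + w * v ^+ n.
Proof.
rewrite exprS coefM !big_ord_recl big_ord0 addr0 /= coef0_line coef0_line_exp.
by rewrite coefD coefC coefMX coefC /= add0r.
Qed.

Lemma coef1_line_exp_diag v n : (line v v ^+ n)`_1 = n%:R * v ^+ n.
Proof.
elim: n => [|n IHn]; first by rewrite expr0 coef1 mul0r.
by rewrite coef1_line_exp IHn -natr1 mulrDl mul1r exprS !mulrA (commr_nat v n).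
Qed.

Lemma mult_op_coef1_line v n : mult_op (fun w => (line v w ^+ n)`_1).
Proof.
elim: n => [|n IHn].
  by apply: mult_op_ext (mult_op0 D) _ => w; rewrite expr0 coef1.
apply: (mult_op_ext (T := fun w => v * (line v w ^+ n)`_1 + w * v ^+ n)).
  by apply: mult_opD; [exact: mult_op_mull|apply/mult_op_mulr/mult_op_id].
by move=> w; rewrite coef1_line_exp.
Qed.

Hypothesis char0 : [pchar D] =i pred0.

Lemma alg_deg_limit d (s : F -> D) c :
  regular s c -> almost_all (fun t => alg_deg d (s t)) -> alg_deg d c.
Proof.
move=> sc s_d; apply/alg_deg_lin_dep.
apply: (@lin_dep_limit _ char0 _ (fun i t => s t ^+ i)).
  by move=> i; exact: regularX.
by apply: almost_all_imp s_d => t /alg_deg_lin_dep.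
Qed.

(* At a value v0 of phi of maximal degree, with minimal polynomial f, let
   E w be the derivative of f at v0 in the direction w, i.e. the coefficient of
   X in f(v0 + w X). As the degree does not increase along v0 + t phi z,
   the limit t -> 0 forces E (phi z) into the field F[v0], so E o phi has finite
   rank; it is nonzero as E v0 = f'(v0) v0. *)
Lemma centrally_finite_of_bounded_image phi d y0 :
  mult_op phi -> phi y0 != 0 -> (forall y, alg_deg d (phi y)) ->
  centrally_finite D.
Proof.
move=> op_phi phi0; elim: d => [|d IHd] phi_d.
  by case: (not_alg_deg0 (phi_d 0)).
have [all_d|/existsNP [y2 y2_d]] := pselect (forall y, alg_deg d (phi y)).
  exact: IHd.
(* A nonzero value is needed. If [phi y2 = 0], failing the bound [d] forces [d = 0], and then [y0]
   serves. *)
have {y2 y2_d} [y1 v0 y1_d] : exists2 y1, phi y1 != 0 & ~ alg_deg d (phi y1).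
  have [y20|] := eqVneq (phi y2) 0; last by exists y2.
  case: d {IHd phi_d} y2_d => [_|d]; last first.
    by rewrite y20 => -[]; exact: alg_degS_zero.
  by exists y0 => //; exact: not_alg_deg0.
have [f [f0 f_d fv]] := phi_d y1.
set v := phi y1 in v0 y1_d fv.
have fd0 : f`_d.+1 != 0.
  apply: contra_notN y1_d => /eqP fd; exists f; split=> //.
  apply/leq_sizeP => j; rewrite leq_eqVlt => /predU1P[<- //|dj].
  by rewrite nth_default // (leq_trans f_d).
have {}fv := (annihilatesE v f_d).1 fv.
pose P w := \sum_(i < d.+2) (val f`_i)%:P * line v w ^+ i.
pose E w := (P w)`_1.
have EE w : E w = \sum_(i < d.+2) val f`_i * (line v w ^+ i)`_1.
  by rewrite /E coef_sum; apply: eq_bigr => i _; rewrite coefCM.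
have P0 w : (P w)`_0 = 0.
  rewrite coef_sum -[RHS]fv; apply: eq_bigr => i _.
  by rewrite coefCM coef0_line_exp.
have op_E : mult_op E.
  apply: mult_op_ext (fun w => esym (EE w)).
  apply: mult_op_sum => i; apply: mult_op_mull; exact: mult_op_coef1_line.
(* E v = f'(v) v. In characteristic 0, f' is nonzero of degree at most [d], so f'(v) = 0 would
   contradict the choice of v. *)
have Ev : E v != 0.
  have size_df : (size f^`() <= d.+1)%N.
    by rewrite -ltnS; apply: leq_trans (lt_size_deriv f0) f_d.
  apply: contra_notN y1_d => /eqP Ev; exists f^`(); split=> //.
  - apply: contraNneq fd0 => df0; have := coef_deriv f d.
    rewrite df0 coef0 -mulr_natr => /esym/eqP; rewrite mulf_eq0.
    by rewrite (negPf (natr_center_neq0 char0 d)) orbF.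
  - apply/(annihilatesE v size_df).
    apply/eqP/negPn/negP => df0; case/eqP: (divring_mulf_neq0 df0 v0).
    rewrite -[RHS]Ev EE [in RHS]big_ord_recl coef1_line_exp_diag.
    rewrite mul0r mulr0 add0r mulr_suml.
    apply: eq_bigr => i _; rewrite coef1_line_exp_diag coef_deriv.
    by rewrite rmorphMn -mulr_natr -!mulrA exprSr.
have E_span z : in_span (fun i : 'I_d.+1 => v ^+ i) (E (phi z)).
  set w := phi z.
  have [Q PQ Q0] := poly_divX (P0 w).
  (* With u = v + t w and P = Q X, the family Q(t), 1, u, ..., u^d has the limit E w, 1, v, ...,
     v^d. Index [ord0] carries the first entry. *)
  pose s (i : 'I_d.+2) t :=
    if unlift ord0 i is Some j then (line v w).[val t] ^+ j else Q.[val t].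
  pose e (i : 'I_d.+2) := if unlift ord0 i is Some j then v ^+ j else E w.
  have e_dep : lin_dep e.
    apply: (@lin_dep_limit _ char0 _ s).
      move=> i; rewrite /s /e; case: (unlift ord0 i) => [j|].
        apply: regularX; have := regular_poly (line v w).
        by rewrite coef0_line.
      by rewrite -[E w]Q0; exact: regular_poly.
    apply: almost_all_imp (almost_all_neq 0) => t t0.
    have lineE : (line v w).[val t] = phi (y1 + val t * z).
      rewrite (mult_opDr op_phi) (mult_opZ op_phi) hornerD hornerC.
      by rewrite hornerM_center hornerC hornerX centralC.
    have [h [h0 h_d hu]] := phi_d (y1 + val t * z).
    move: hu; rewrite -lineE => hu.
    set u := (line v w).[val t] in hu.
    have {}hu := (annihilatesE u h_d).1 hu.
    (* Since h(u) = 0 and f(u) = t Q(t), eliminating u^(d+1) between h(u) and f(u) gives this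
       dependence. *)
    exists (fun i => if unlift ord0 i is Some j then
                     f`_d.+1 * h`_j - h`_d.+1 * f`_j else h`_d.+1 * t).
      have [hd|hd] := eqVneq h`_d.+1 0; last first.
        by exists ord0; rewrite unlift_none mulf_neq0.
      apply: contrapT => no_i; case/eqP: h0; apply/polyP => j; rewrite coef0.
      have [j_d|d_j] := ltnP j d.+1.
        apply/eqP/negPn/negP => hj; apply: no_i.
        exists (lift ord0 (Ordinal j_d)).
        by rewrite liftK hd mul0r subr0 mulf_neq0.
      move: d_j; rewrite leq_eqVlt => /predU1P[<- //|d_j].
      by rewrite nth_default // (leq_trans h_d).
    have Pt : Q.[val t] * val t = \sum_(i < d.+2) val f`_i * u ^+ i.
      rewrite -[X in _ * X]hornerX -hornerM_center -PQ horner_sum.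
      by apply: eq_bigr => i _; rewrite hornerM_center hornerC horner_exp_center.
    rewrite big_ord_recl /s unlift_none rmorphM -mulrA (centralC t) Pt.
    rewrite (eq_bigr (fun i : 'I_d.+1 => val f`_d.+1 * (val h`_i * u ^+ i) -
                        val h`_d.+1 * (val f`_i * u ^+ i))); last first.
      by move=> i _; rewrite liftK rmorphB !rmorphM mulrBl !mulrA.
    rewrite sumrB -!mulr_sumr.
    have recr (G : nat -> D) :
        \sum_(i < d.+2) G i = \sum_(i < d.+1) G i + G d.+1.
      by rewrite big_ord_recr.
    rewrite (recr (fun i => val f`_i * u ^+ i)).
    move: hu; rewrite (recr (fun i => val h`_i * u ^+ i)) => /eqP.
    rewrite addr_eq0 => /eqP ->.
    rewrite mulrDr [X in _ + X]addrC addrACA subrr add0r mulrN !mulrA -!rmorphM.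
    by rewrite [h`_d.+1 * _]mulrC subrr.
  have {}e_dep := lin_dep_span e_dep.
  have {e_dep} := e_dep _; rewrite /e unlift_none.
  have eE : (fun i => (if unlift ord0 (lift ord0 i) is Some j then v ^+ j
                       else E w)) = (fun i : 'I_d.+1 => v ^+ i).
    by apply: funext => i; rewrite liftK.
  rewrite eE; apply.
  by move/alg_deg_lin_dep.
apply: (@centrally_finite_of_finite_rank _ (E \o phi) y1) E_span.
  exact: mult_op_comp.
exact: Ev.
Qed.
End BoundedDegree.

(** * Curves in almost subnormal subgroups *)

Section FiniteIndex.
Local Open Scope group_scope.
Variable G : groupType.
Implicit Types (H K : set G) (x y : G).

Lemma subgroup1 H : subgroup H -> H 1.
Proof. by move=> [H1 _]; move: H1; rewrite !inE. Qed.

Lemma subgroup_div H x y : subgroup H -> H x -> H y -> H (x * y^-1).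
Proof.
move=> [_ Hdiv] Hx Hy; have := Hdiv x y.
by rewrite !inE; apply.
Qed.

Lemma subgroupV H x : subgroup H -> H x -> H x^-1.
Proof.
by move=> sH Hx; rewrite -[_^-1]mul1g; exact: subgroup_div (subgroup1 sH) Hx.
Qed.

Lemma subgroupM H x y : subgroup H -> H x -> H y -> H (x * y).
Proof.
move=> sH Hx Hy; rewrite -[y]invgK.
exact: subgroup_div Hx (subgroupV sH Hy).
Qed.

Lemma subgroupX H x n : subgroup H -> H x -> H (x ^+ n).
Proof.
move=> sH Hx; elim: n => [|n IHn]; first by rewrite expg0; exact: subgroup1.
by rewrite expgS; apply: subgroupM.
Qed.

(** Among the cosets of 1, x, ..., x^n, where n is the length of a list of all cosets, two coincide.
    So K contains some x^(j-i) with 0 < j - i <= n, and n! is a multiple of j - i that does not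
    depend on x. *)
Lemma finite_index_exponent K H : subgroup K -> subgroup H ->
  finite_index_in K H -> exists m, forall x, H x -> K (x ^+ m.+1).
Proof.
move=> sK sH /finite_seqP [s sE]; exists (size s)`!.-1 => x Hx.
rewrite prednK ?fact_gt0 //.
pose cosets := [seq left_coset K (x ^+ i) | i <- iota 0 (size s).+1].
have : ~~ uniq cosets.
  apply/negP => /uniq_leq_size le_s.
  suff : (size cosets <= size s)%N by rewrite size_map size_iota ltnn.
  apply: le_s => _ /mapP [i _ ->].
  have : [set left_coset K y | y in H]%classic (left_coset K (x ^+ i)).
    by exists (x ^+ i) => //; exact: subgroupX.
  by rewrite sE.
move=> /(uniqPn set0) [i [j [ij]]]; rewrite size_map size_iota => j_s.
rewrite !(nth_map 0%N) ?size_iota ?(ltn_trans ij) //.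
rewrite !nth_iota ?(ltn_trans ij) //.
rewrite !add0n => eq_coset.
have [k Kk kE] : left_coset K (x ^+ i) (x ^+ j).
  by rewrite eq_coset; exists 1; [exact: subgroup1|rewrite mulg1].
have {}kE : k = x ^+ (j - i).
  apply: (mulgI (x ^+ i)).
  by rewrite kE -expgnDr subnKC // ltnW.
have /dvdnP [q ->] : (j - i %| (size s)`!)%N.
  apply: dvdn_fact; rewrite subn_gt0 ij /=.
  by apply: leq_trans (leq_subr _ _) _.
by rewrite mulnC expgnA -kE; apply: subgroupX.
Qed.
End FiniteIndex.

(** * First-order expansion of curves through 1 *)

Section Tangent.
Variable D : divisionRingType.
Local Notation F := (center D).
Implicit Types (s : F -> D) (c b y : D).

(** This is s(t) = 1 + t c + O(t^2), the remainder being absorbed in the regular function [v]. *)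
Definition tangent s c : Prop :=
  exists2 v : F -> D, regular v c & almost_all (fun t => s t = 1 + val t * v t).

Lemma tangent_regular s c : tangent s c -> regular s 1.
Proof.
move=> [v vc sv]; rewrite -[1]addr0 -[0](mul0r c).
apply: regular_ext (regularD (regular_cst 1) (regularM (regular_param D) vc)) _.
by apply: almost_all_imp sv => t ->.
Qed.

Lemma tangent_line y : tangent (fun t => 1 + val t * y) y.
Proof. by exists (fun=> y); [exact: regular_cst|exact: almost_allT]. Qed.

Lemma tangent_ext s s' c :
  tangent s c -> almost_all (fun t => s t = s' t) -> tangent s' c.
Proof.
move=> [v vc sv] ss'; exists v => //.
by apply: almost_all_imp (almost_all_and sv ss') => t [<- ->].
Qed.

Lemma tangentM s s' c c' :
  tangent s c -> tangent s' c' -> tangent (fun t => s t * s' t) (c + c').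
Proof.
move=> [v vc sv] [v' vc' sv'].
exists (fun t => v t + v' t + val t * v t * v' t).
  rewrite -[c + c']addr0 -[0](mul0r c') -[X in X * c'](mul0r c).
  apply: regularD (regularD vc vc') _.
  exact: regularM (regularM (regular_param D) vc) vc'.
apply: almost_all_imp (almost_all_and sv sv') => t [-> ->].
rewrite mulrDl mul1r !mulrDr mulr1 !addrA; congr (_ + _).
  by rewrite -!addrA [X in _ + X]addrC.
by rewrite !mulrA -[_ * v t * val t]mulrA -(centralC t (v t)) !mulrA.
Qed.

Lemma tangentV s c : tangent s c -> tangent (fun t => (s t)^-1) (- c).
Proof.
move=> sc; have s1 := tangent_regular sc; case: sc => v vc sv.
(* From (1 + t v) s^-1 = 1 one reads s^-1 = 1 - t v s^-1. *)
exists (fun t => - (v t * (s t)^-1)).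
  by rewrite -[c in - c]mulr1; apply/regularN/(regularM vc)/regularV.
have s0 := regular_neq0 s1 (oner_neq0 D).
apply: almost_all_imp (almost_all_and sv s0) => t [st st0].
have -> : val t * - (v t * (s t)^-1) = (1 - s t) * (s t)^-1.
  by rewrite {2}st opprD addNKr mulrN mulrA mulNr.
by rewrite mulrBl mul1r divring_mulrV // addrC subrK.
Qed.

Lemma tangent_conj s c b :
  b != 0 -> tangent s c -> tangent (fun t => b * s t * b^-1) (b * c * b^-1).
Proof.
move=> b0 [v vc sv]; exists (fun t => b * v t * b^-1).
  exact: regularM (regularM (regular_cst b) vc) (regular_cst _).
apply: almost_all_imp sv => t ->.
rewrite mulrDr mulr1 mulrDl divring_mulrV //; congr (1 + _).
by rewrite !mulrA -centralC.
Qed.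

Lemma tangentX s c n : tangent s c -> tangent (fun t => s t ^+ n) (n%:R * c).
Proof.
move=> sc; elim: n => [|n IHn].
  exists (fun=> 0); first by rewrite mul0r; exact: regular_cst.
  by apply: almost_allT => t; rewrite mulr0 addr0.
rewrite -add1n natrD mulrDl mul1r.
apply: tangent_ext (tangentM sc IHn) _.
by apply: almost_allT => t; rewrite exprS.
Qed.

(** The linearization at s = 1 of the commutator s b s^-1 b^-1. *)
Definition twisted_diff b y := y - b * y * b^-1.

Lemma mult_op_twisted_diff b : mult_op (twisted_diff b).
Proof. by apply: mult_opB (mult_op_id D) (mult_op_sandwich b b^-1). Qed.

Lemma tangent_commutator s c b : b != 0 -> tangent s c ->
  tangent (fun t => s t * b * (s t)^-1 * b^-1) (twisted_diff b c).
Proof.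
move=> b0 sc; have := tangentM sc (tangent_conj b0 (tangentV sc)).
rewrite mulrN mulNr => /tangent_ext; apply.
by apply: almost_allT => t; rewrite !mulrA.
Qed.

Lemma val_unitX (x : unit_group D) n : val (x ^+ n)%g = val x ^+ n.
Proof. by elim: n => [|n IHn]; rewrite ?expg0 // expgS exprS -IHn. Qed.

(* A curve 1 + t y in D^* is pushed down the series by commutators with b
   at the normal steps and by powers at the steps of finite index. *)
Lemma almost_subnormal_tangent (N : set (unit_group D)) (b : unit_group D) :
  almost_subnormal N -> N b ->
  exists k e, forall y, exists X : F -> unit_group D,
    (forall t, N (X t)) /\
    tangent (fun t => val (X t)) (k.+1%:R * iter e (twisted_diff (val b)) y).
Proof.
move=> [r [S [S0 Sr sub_S step]]] Nb.
have Sb i : (i <= r)%N -> S i b.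
  move=> ir; rewrite -(subKn ir); elim: (r - i)%N (leq_subr i r) => [|j IHj] jr.
    by rewrite subn0 Sr.
  have [|+ _] := step (r - j.+1)%N; first by rewrite subnSK ?leq_subr.
  by apply; rewrite subnSK //; apply: IHj; apply: ltnW.
have b0 : val b != 0.
  by apply: contraTneq (valP b) => ->; rewrite unitr0.
rewrite -Sr; elim: {1 3}r (leqnn r) => [|i IHi] ir.
  exists 0%N, 0%N => y.
  pose x (t : F) : D := 1 + val t * y.
  (* The default 1 is taken only where 1 + t y = 0, which [almost_all] ignores. *)
  exists (fun t => insubd (1%g : unit_group D) (x t)); split.
    by move=> t; rewrite S0.
  rewrite mul1r /=; apply: tangent_ext (tangent_line y) _.
  have x0 := regular_neq0 (tangent_regular (tangent_line y)) (oner_neq0 D).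
  apply: almost_all_imp x0 => t xt.
  by rewrite val_insubd divring_unitP.
have [k [e IHy]] := IHi (ltnW ir).
have sSi := sub_S i (ltnW ir); have sSi1 := sub_S i.+1 ir.
have [_ [normal_i|/(finite_index_exponent sSi1 sSi) [m Sm]]] := step i ir.
  exists k, e.+1 => y; have [X [SX tanX]] := IHy y.
  exists (fun t => X t * b * (X t)^-1 * b^-1)%g; split.
    move=> t; apply: subgroup_div (Sb _ ir) => //.
    (* As [b ^ x] is x^-1 b x, normality is applied to the inverse of [X t]. *)
    have := normal_i (X t)^-1%g b (subgroupV sSi (SX t)) (Sb _ ir).
    by rewrite conjgE invgK mulgA.
  have := tangent_commutator b0 tanX.
  by rewrite (mult_op_natr _ _ (mult_op_twisted_diff _)).
(* Raising to the power m + 1 multiplies the tangent vector by m + 1; the predecessor matches the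
   form [k.+1] of the constant. *)
exists (m.+1 * k.+1).-1, e => y; have [X [SX tanX]] := IHy y.
exists (fun t => X t ^+ m.+1)%g; split.
  by move=> t; apply: Sm.
rewrite prednK ?muln_gt0 // natrM -mulrA.
apply: tangent_ext (tangentX m.+1 tanX) _.
by apply: almost_allT => t; rewrite val_unitX.
Qed.
End Tangent.

(** * Iterated inner derivations *)

Section NonVanishing.
Variable D : divisionRingType.
Hypothesis char0 : [pchar D] =i pred0.
Variable b : D.
Hypothesis b_noncentral : b \notin center_pred D.
Implicit Types (a g h w y z : D).

(** This equals [twisted_diff b y * b]. Unlike [twisted_diff], it obeys the ordinary Leibniz
    rule. *)
Definition inner_deriv y := y * b - b * y.
Local Notation delta := inner_deriv.

Lemma inner_derivM y z : delta (y * z) = delta y * z + y * delta z.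
Proof.
by rewrite /delta mulrBl mulrBr !mulrA [RHS]addrC addrA subrK.
Qed.

Lemma mult_op_inner_deriv : mult_op delta.
Proof.
apply: (mult_op_ext (T := fun y => y * b - b * y)) => //.
by apply: mult_opB; [apply: mult_op_mulr|apply: mult_op_mull]; exact: mult_op_id.
Qed.

Lemma inner_deriv_eq0 y : delta y = 0 <-> GRing.comm y b.
Proof.
by split=> [/eqP|yb]; [rewrite subr_eq0 => /eqP|rewrite /delta yb subrr].
Qed.

Lemma iter_inner_deriv_exp h n : delta h = 1 -> iter n delta (h ^+ n) = n`!%:R.
Proof.
move=> h1.
have hX m : delta (h ^+ m.+1) = m.+1%:R * h ^+ m.
  elim: m => [|m IHm]; first by rewrite expr1 expr0 h1 mulr1.
  rewrite exprS inner_derivM h1 mul1r IHm mulrA (commr_nat h) -mulrA -exprS.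
  by rewrite -[m.+2]add1n natrD mulrDl mul1r.
elim: n => [|n IHn]; first by rewrite fact0.
rewrite iterSr hX (mult_op_natr _ _ (mult_op_iter _ mult_op_inner_deriv)) IHn.
by rewrite -natrM factS.
Qed.

(* If delta were nilpotent there would be z with delta z nonzero and
   delta (delta z) = 0; then h = z (delta z)^-1 has delta h = 1. *)
Lemma inner_deriv_not_nilpotent n : exists y, iter n delta y != 0.
Proof.
case: n => [|n]; first by exists 1; exact: oner_neq0.
elim: n => [|n [y yn]].
  apply: contrapT => no_y; move/negP: b_noncentral; apply; apply/center_predP.
  move=> x; apply/esym/(inner_deriv_eq0 x).
  by apply/eqP/negPn/negP => dx; apply: no_y; exists x.
apply: contrapT => no_y.
have nil x : iter n.+2 delta x = 0.
  by apply/eqP/negPn/negP => dx; apply: no_y; exists x.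
pose z := iter n delta y; pose w := delta z.
have dwV : delta w^-1 = 0.
  apply/inner_deriv_eq0/commr_sym/commrV/commr_sym/inner_deriv_eq0; exact: nil.
have h1 : delta (z * w^-1) = 1.
  by rewrite inner_derivM dwV mulr0 addr0 divring_mulrV.
(* The iterate that should vanish sends h^(n+2) to (n+2)!, nonzero in characteristic 0. *)
have := iter_inner_deriv_exp n.+2 h1; rewrite nil => /esym/eqP.
have := natr_center_neq0 char0 (n.+2)`!.-1; rewrite prednK ?fact_gt0 //.
by rewrite -(inj_eq val_inj) rmorph_nat => /negPf ->.
Qed.

(** Suppose all values of delta^(n+1) commute with a but z = delta^n y does not. For g in the
    centralizer of a, delta^(n+1) (z g) equals z delta^(n+1) g up to an element of that centralizer,
    which forces delta^(n+1) g = 0. The values of delta^(n+1) being such g, delta^(2n+2) = 0,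
    against non-nilpotency. *)
Lemma iter_inner_deriv_not_comm a n :
  a \notin center_pred D -> GRing.comm a b ->
  exists y, ~ GRing.comm a (iter n delta y).
Proof.
move=> a_noncentral ab; elim: n => [|n [y yn]].
  apply: contrapT => no_y; move/negP: a_noncentral; apply; apply/center_predP.
  by move=> x; apply: contrapT => ax; apply: no_y; exists x.
apply: contrapT => no_y.
have comm_n x : GRing.comm a (iter n.+1 delta x).
  by apply: contrapT => ax; apply: no_y; exists x.
pose z := iter n delta y.
have comm_delta x : GRing.comm a x -> GRing.comm a (delta x).
  by move=> ax; apply: commrB; apply: commrM.
have nil g : GRing.comm a g -> iter n.+1 delta g = 0.
  move=> ag.
  have comm_iter i : GRing.comm a (iter i delta g) /\
      GRing.comm a (iter i delta (z * g) - z * iter i delta g).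
    elim: i => [|i [agi azi]].
      by rewrite subrr; split=> //; exact: commr0.
    split; first exact: comm_delta.
    have dz : GRing.comm a (delta z) by exact: comm_n.
    have -> : iter i.+1 delta (z * g) - z * iter i.+1 delta g =
        delta (iter i delta (z * g) - z * iter i delta g) +
        delta z * iter i delta g.
      rewrite !iterS (mult_opBr mult_op_inner_deriv) inner_derivM.
      by rewrite opprD addrA [RHS]addrAC subrK.
    by apply: commrD; [exact: comm_delta|exact: commrM].
  have [agn azn] := comm_iter n.+1.
  apply: contrapT => /eqP gn; apply: yn.
  have -> : iter n delta y = z * iter n.+1 delta g * (iter n.+1 delta g)^-1.
    by rewrite -mulrA divring_mulrV ?mulr1.
  apply: commrM; last exact: commrV.
  rewrite -[X in GRing.comm a X](subKr (iter n.+1 delta (z * g))).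
  exact: commrB.
have [x] := inner_deriv_not_nilpotent (n.+1 + n.+1).
by rewrite iterD nil ?eqxx.
Qed.

Lemma iter_twisted_diff_mul n y :
  iter n (twisted_diff b) (y * b) = iter n (twisted_diff b) y * b.
Proof.
elim: n => // n IHn; rewrite !iterS IHn /twisted_diff mulrBl.
have b0 : b != 0 by apply: contraNneq b_noncentral => ->; exact: rpred0.
by rewrite -!mulrA divring_mulrV // divring_mulVr // !mulr1.
Qed.

Lemma iter_inner_derivE n y :
  iter n delta y = iter n (twisted_diff b) y * b ^+ n.
Proof.
have b0 : b != 0 by apply: contraNneq b_noncentral => ->; exact: rpred0.
elim: n => [|n IHn]; first by rewrite mulr1.
rewrite !iterS IHn /delta /twisted_diff mulrBl; congr (_ - _).
  by rewrite exprSr mulrA.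
by rewrite exprS -!mulrA [b^-1 * _]mulrA divring_mulVr // mul1r.
Qed.

(** If all values commuted with a, then so would b, as the quotient of the values at y b and at y.
    Multiplying by b^n would then make all values of the iterated inner derivation commute with
    a. *)
Lemma iter_twisted_diff_not_comm a n : a \notin center_pred D ->
  exists y, ~ GRing.comm a (iter n (twisted_diff b) y).
Proof.
move=> a_noncentral; apply: contrapT => no_y.
have comm_n x : GRing.comm a (iter n (twisted_diff b) x).
  by apply: contrapT => ax; apply: no_y; exists x.
have ab : GRing.comm a b.
  have [y] := inner_deriv_not_nilpotent n; rewrite iter_inner_derivE => yn.
  have {}yn : iter n (twisted_diff b) y != 0.
    by apply: contraNneq yn => ->; rewrite mul0r.
  rewrite -[b]mul1r -(divring_mulVr yn) -mulrA -iter_twisted_diff_mul.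
  by apply: commrM => //; exact: commrV.
have [y] := iter_inner_deriv_not_comm n a_noncentral ab; apply.
by rewrite iter_inner_derivE; apply: commrM => //; exact: commrX.
Qed.
End NonVanishing.

Theorem corollary1p5 (D : divisionRingType) (N : set (unit_group D))
    (hNsub : almost_subnormal N)
    (hNnc : non_central N)
    (hchar : [pchar D] =i pred0)
    (halg : exists a : D, a \notin center_pred D /\
      exists d : nat, (0 < d)%N /\
        forall x : unit_group D, N x ->
          algebraic_of_degree_at_most d (a * val x * a^-1 * (val x)^-1)) :
  centrally_finite D.
Proof.
move: halg => [a [a_noncentral [d [_ alg_a]]]].
have a0 : a != 0 by apply: contraNneq a_noncentral => ->; exact: rpred0.
have [b /not_implyP [Nb /negP b_noncentral]] := (existsNP _).2 hNnc.
have [k [e curve]] := almost_subnormal_tangent hNsub Nb.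
pose L y := k.+1%:R * iter e (twisted_diff (val b)) y.
have op_L : mult_op L by apply/mult_op_mull/mult_op_iter/mult_op_twisted_diff.
have [y0 ay0] := iter_twisted_diff_not_comm hchar b_noncentral e a_noncentral.
apply: (@centrally_finite_of_bounded_image D hchar
          (fun y => a * L y * a^-1 - L y) d y0).
- exact: mult_opB (mult_op_mulr _ (mult_op_mull _ op_L)) op_L.
(* The vanishing would mean that a commutes with [L y0], hence, k + 1 being invertible, with the
   iterate at [y0]. *)
- rewrite subr_eq0; apply: contra_notN ay0 => /eqP aL.
  have k0 : k.+1%:R != 0 :> D.
    by have := natr_center_neq0 hchar k; rewrite -(inj_eq val_inj) rmorph_nat.
  have {}aL : GRing.comm a (L y0).
    by rewrite /GRing.comm -[in RHS]aL -mulrA divring_mulVr ?mulr1.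
  have -> : iter e (twisted_diff (val b)) y0 = k.+1%:R^-1 * L y0.
    by rewrite /L mulrA divring_mulVr // mul1r.
  exact: commrM (commrV (commr_nat a k.+1)) aL.
- move=> y; have [X [NX tanX]] := curve y.
  (* The commutator of a with the curve is 1 + t v(t), with v(0) the value of the operator at y. The
     bound passes to v(t) for almost all t, then to the limit. *)
  have [v v_reg vE] := tangentM (tangent_conj a0 tanX) (tangentV tanX).
  apply: (alg_deg_limit hchar v_reg).
  apply: almost_all_imp (almost_all_and vE (almost_all_neq 0)) => t [vt t0].
  apply: (alg_deg_affine (a := 1) t0).
  by rewrite rmorph1 -vt; apply/alg_deg_of_minimal/alg_a.
Qed.
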